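(* Let $\lambda\ge\lambda_0$ be such that every state of $\mathcal{E}^o\cup\mathcal{E}^a$ is transient for $\{\varphi^\lambda_t\}_{t\ge0}$ (so that $\tau<\infty$ almost surely from every starting state in $\mathcal{E}^o\cup\mathcal{E}^a$). Let $M=\begin{bmatrix}T^+-\lambda I & T^-\\ T^- & T^+-\lambda I\end{bmatrix}$ (a $2p\times 2p$ matrix). Then for every $i\in\{1,\dots,p\}$ the signed measure $$B\mapsto \mathbb{E}_{i^o}\big[\mathbb{1}\{\tau\in B\}\,\beta(\varphi^\lambda_\tau)\big]=\mathbb{P}_{i^o}(\tau\in B,\varphi^\lambda_\tau=\Delta^o)-\mathbb{P}_{i^o}(\tau\in B,\varphi^\lambda_\tau=\Delta^a)$$ on Borel sets $B\subseteq[0,\infty)$ is absolutely continuous with respect to Lebesgue measure, with density $$x\mapsto \bm{e}_i^\intercal e^{(T-\lambda I)x}\bm{s}=(\bm{e}_i^\intercal,\bm{0})\,e^{Mx}\begin{bmatrix}\bm{s}\\-\bm{s}\end{bmatrix},\qquad x\ge0.$$ Moreover, the signed measure $B\mapsto \mathbb{E}_{i^a}[\mathbb{1}\{\tau\in B\}\beta(\varphi^\lambda_\tau)]$ has density $$x\mapsto -\bm{e}_i^\intercal e^{(T-\lambda I)x}\bm{s}=(\bm{0},\bm{e}_i^\intercal)\,e^{Mx}\begin{bmatrix}\bm{s}\\-\bm{s}\end{bmatrix},\qquad x\ge0.$$ Here $\bm{e}_i$ is the $i$-th standard basis column vector of $\mathbb{R}^p$ and $\bm{0}$ the zero row vector of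 $\mathbb{R}^p$.
   Context: Let $p\ge1$, let $T=(t_{ij})_{1\le i,j\le p}$ be a real $p\times p$ matrix and $\bm{s}=(s_1,\dots,s_p)^\intercal$ a real column vector. Define $p\times p$ matrices $T^+=(t^+_{ij})$, $T^-=(t^-_{ij})$ by $t^+_{ij}=\max\{0,t_{ij}\}$, $t^-_{ij}=\max\{0,-t_{ij}\}$ for $i\neq j$, and $t^+_{ii}=t_{ii}$, $t^-_{ii}=0$ (so $T^+$ has nonnegative off-diagonal entries, $T^-$ is nonnegative, and $T=T^+-T^-$). Define column vectors $\bm{s}^\pm$ by $s^\pm_i=\max\{0,\pm s_i\}$, so $\bm{s}=\bm{s}^+-\bm{s}^-$. Let $\lambda_0=\min\{r\ge0:\ t_{ii}+\sum_{j\neq i}|t_{ij}|+|s_i|\le r\text{ for all }1\le i\le p\}$. For $\lambda\ge\lambda_0$, let $\{\varphi^\lambda_t\}_{t\ge0}$ be a continuous-time Markov jump process on $\mathcal{E}=\mathcal{E}^o\cup\mathcal{E}^a\cup\{\Delta^o\}\cup\{\Delta^a\}$, where $\mathcal{E}^o=\{1^o,\dots,p^o\}$ (''original states'') and $\mathcal{E}^a=\{1^a,\dots,p^a\}$ (''anti-states''), with subintensity matrix (states ordered $\mathcal{E}^o,\mathcal{E}^a,\Delta^o,\Delta^a$) $$G=\begin{bmatrix}T^+-\lambda I & T^- & \bm{s}^+ & \bm{s}^-\\ T^- & T^+-\lambda I & \bm{s}^- & \bm{s}^+\\ \bm{0}&\bm{0}&0&0\\ \bm{0}&\bm{0}&0&0\end{bmatrix}.$$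 Thus $\Delta^o,\Delta^a$ are absorbing, and from a state in $\mathcal{E}^o\cup\mathcal{E}^a$ the process is killed (terminated) at rate equal to minus the corresponding row sum of $G$ (which is $\ge0$ since $\lambda\ge\lambda_0$); upon killing it is sent to a cemetery state $\dagger$. Let $\tau=\inf\{x\ge0:\varphi^\lambda_x\notin\mathcal{E}^o\cup\mathcal{E}^a\}$ and define $\beta(\Delta^o)=1$, $\beta(\Delta^a)=-1$, $\beta(\dagger)=0$. For $j\in\mathcal{E}$, $\mathbb{P}_j,\mathbb{E}_j$ denote probability and expectation conditional on $\varphi^\lambda_0=j$. *)

(* Defs.v *)
From HB Require Import structures.
From mathcomp Require Import all_boot all_order all_algebra.
From mathcomp Require Import all_classical all_reals all_analysis.
Set Implicit Arguments. Unset Strict Implicit. Unset Printing Implicit Defensive.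
Import Order.TTheory GRing.Theory Num.Theory numFieldNormedType.Exports.
Local Open Scope classical_set_scope.
Local Open Scope ring_scope.

Section Defs.
Variable R : realType.

Definition expmx (n : nat) (A : 'M[R]_n) : 'M[R]_n :=
  \matrix_(i, j) limn (series (fun k : nat => ((A ^+ k) i j / (k`!)%:R : R))).

Variable p : nat.
Variables (T : 'M[R]_p) (s : 'cV[R]_p) (lam : R).

Definition Tplus : 'M[R]_p :=
  \matrix_(i, j) if i == j then T i i else Num.max 0 (T i j).
Definition Tminus : 'M[R]_p :=
  \matrix_(i, j) if i == j then 0 else Num.max 0 (- T i j).
Definition splus : 'cV[R]_p := \col_i Num.max 0 (s i 0).
Definition sminus : 'cV[R]_p := \col_i Num.max 0 (- s i 0).

(* lambda_0 = min { r >= 0 : t_ii + sum_{j<>i} |t_ij| + |s_i| <= r for all i } *)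
Definition lambda0 : R :=
  \big[Num.max/0]_(i < p)
     (T i i + \sum_(j < p | j != i) `|T i j| + `|s i 0|).

Definition Mblock : 'M[R]_(p + p) :=
  block_mx (Tplus - lam%:M) Tminus Tminus (Tplus - lam%:M).

(* Rates into Delta^o (first column) and Delta^a (second column). *)
Definition Gabs : 'M[R]_(p + p, 1 + 1) :=
  row_mx (col_mx splus sminus) (col_mx sminus splus).

Definition killrate : 'cV[R]_(p + p) :=
  \col_k - (\sum_j Mblock k j + \sum_j Gabs k j).

(* State space E^o, E^a, Delta^o, Delta^a, dagger (cemetery), in this order. *)
Definition state := 'I_((p + p) + ((1 + 1) + 1)).
Definition sOrig (i : 'I_p) : state := lshift ((1 + 1) + 1) (lshift p i).
Definition sAnti (i : 'I_p) : state := lshift ((1 + 1) + 1) (rshift p i).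
Definition sDeltaO : state := rshift (p + p) (lshift 1 (lshift 1 (ord0 : 'I_1))).
Definition sDeltaA : state := rshift (p + p) (lshift 1 (rshift 1 (ord0 : 'I_1))).
Definition sDagger : state := rshift (p + p) (rshift (1 + 1) (ord0 : 'I_1)).

Definition inEoa (x : state) : bool := (x < p + p)%N.

(* Full (conservative) generator on E \cup {dagger}: G together with the
   killing column towards dagger; Delta^o, Delta^a, dagger are absorbing. *)
Definition Qgen : 'M[R]_((p + p) + ((1 + 1) + 1)) :=
  block_mx Mblock (row_mx Gabs killrate) 0 0.

End Defs.

Section Process.
Variables (R : realType) (p : nat) (Q : 'M[R]_((p + p) + ((1 + 1) + 1))).
Variables (d : measure_display) (Omega : measurableType d).

(* A Markov family: one path process phi on Omega together with probability
   measures P j (j a state), such that under P j the process is a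
   continuous-time Markov jump process with generator Q started at j:
   measurable coordinates, right-continuous (piecewise constant) paths and
   finite-dimensional distributions given by the transition function
   exp(tQ). *)
Definition markov_family (P : state p -> probability Omega R)
    (phi : R -> Omega -> state p) : Prop :=
  [/\ (forall t (x : state p), measurable [set w | phi t w = x]),
      (forall w t, 0 <= t -> exists2 e : R, 0 < e &
          forall u, t <= u < t + e -> phi u w = phi t w) &
      (forall (j : state p) (n : nat) (t : nat -> R) (x : nat -> state p),
          t 0%N = 0 -> (forall k, t k <= t k.+1) ->
          P j [set w | forall k, (k <= n)%N -> phi (t k) w = x k] =
          ((x 0%N == j)%:R *
            \prod_(k < n) expmx ((t k.+1 - t k) *: Q) (x k) (x k.+1))%:E)].

Definition transient_state (P : state p -> probability Omega R)
    (phi : R -> Omega -> state p) (j : state p) : Prop :=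
  P j [set w | forall N : R, exists2 t, N <= t & phi t w = j] = 0%E.

Definition exit_time (phi : R -> Omega -> state p) (w : Omega) : R :=
  inf [set x | 0 <= x /\ ~~ inEoa (phi x w)].

(* B |-> E_j[ 1{tau in B} beta(phi_tau) ]
       = P_j(tau in B, phi_tau = Delta^o) - P_j(tau in B, phi_tau = Delta^a) *)
Definition exit_signed_measure (P : state p -> probability Omega R)
    (phi : R -> Omega -> state p) (j : state p) (B : set R) : R :=
  fine (P j [set w | B (exit_time phi w) /\
                     phi (exit_time phi w) w = sDeltaO p]) -
  fine (P j [set w | B (exit_time phi w) /\
                     phi (exit_time phi w) w = sDeltaA p]).

End Process.

(* Main.v *)
(* For an absorbing state [D] of the conservative generator [Q], the event
   {tau <= x, phi_tau = D} coincides almost surely with {phi_x = D}, of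
   probability [exp(xQ)_{jD}].  Its derivative [(exp(xQ) Q)_{jD}] is nonnegative,
   so the law of tau on {phi_tau = D} has this density, which is integrable
   because that law is finite.  Finally [Q] maps e_{Delta^o} - e_{Delta^a} to
   (s; -s; 0), and on vectors (u; -u; 0) it acts as [T - lam I] acts on u: the
   difference of the two densities from i^o is therefore that of
   [exp(x (T - lam I)) s]. *)
Require Import Defs.
From HB Require Import structures.
From mathcomp Require Import all_boot all_order all_algebra.
From mathcomp Require Import all_classical all_reals all_analysis.
From mathcomp Require Import measurable_realfun.
Import Order.TTheory GRing.Theory Num.Theory.
Import numFieldNormedType.Exports.
Local Open Scope classical_set_scope.
Local Open Scope ring_scope.

(** * Matrix exponential: convergence of its series and intertwining relations *)

Section MatrixExponential.
Variables (R : realType) (n : nat).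
Implicit Types (A : 'M[R]_n) (x : R) (i j : 'I_n).

(** The sum of all [|A a b|] dominates every row sum, so each further factor [A] costs at most that
    constant. The entries of the exponential series are thereby dominated by a scalar exponential
    series. *)
Lemma mx_expr_bound A k i j : `|(A ^+ k) i j| <= (\sum_a \sum_b `|A a b|) ^+ k.
Proof.
set c := \sum_a _; have c0 : 0 <= c by do 2 apply: sumr_ge0 => ? _.
elim: k i j => [|k IH] i j.
  by rewrite expr0 mxE; case: (i == j); rewrite ?normr1 ?normr0 ?ler01.
rewrite exprS -mulmxE mxE (le_trans (ler_norm_sum _ _ _))// exprS.
apply: (@le_trans _ _ (\sum_b `|A i b| * c ^+ k)).
  by apply: ler_sum => b _; rewrite normrM ler_wpM2l.
rewrite -mulr_suml; apply: ler_wpM2r; first exact: exprn_ge0.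
rewrite /c [leRHS](bigD1 i)//= lerDl.
by do 2 apply: sumr_ge0 => ? _.
Qed.

(** Comparison with a scalar exponential series turns the [limn] in the definition of [expmx] into a
    genuine limit. *)
Lemma cvg_expmx A i j :
  series (fun k => (A ^+ k) i j / k`!%:R) @ \oo --> expmx A i j.
Proof.
rewrite mxE; apply: normed_cvg.
apply: series_le_cvg (is_cvg_series_exp_coeff (\sum_a \sum_b `|A a b|)) => k //=.
  by apply: exp_coeff_ge0; do 2 apply: sumr_ge0 => ? _.
by rewrite normrM normfV normr_nat ler_wpM2r ?invr_ge0// mx_expr_bound.
Qed.

Lemma cvg_expmx_mulmx m A (V : 'M[R]_(n, m)) i (j : 'I_m) :
  series (fun k => (A ^+ k *m V) i j / k`!%:R) @ \oo --> (expmx A *m V) i j.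
Proof.
rewrite [in X in _ --> X]mxE.
rewrite (_ : series _ = fun N =>
  \sum_l series (fun k => (A ^+ k) i l / k`!%:R) N * V l j); last first.
  apply/funext => N; rewrite /series/=.
  under [RHS]eq_bigr do rewrite mulr_suml.
  rewrite exchange_big/=; apply: eq_bigr => k _.
  by rewrite mxE mulr_suml; apply: eq_bigr => l _; rewrite mulrAC.
apply: cvg_big => [|l _]; first exact: add_continuous.
by apply: cvgMl; exact: cvg_expmx.
Qed.

Lemma cvg_mulmx_expmx m A (V : 'M[R]_(m, n)) (i : 'I_m) j :
  series (fun k => (V *m A ^+ k) i j / k`!%:R) @ \oo --> (V *m expmx A) i j.
Proof.
rewrite [in X in _ --> X]mxE.
rewrite (_ : series _ = fun N =>
  \sum_l V i l * series (fun k => (A ^+ k) l j / k`!%:R) N); last first.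
  apply/funext => N; rewrite /series/=.
  under [RHS]eq_bigr do rewrite mulr_sumr.
  rewrite exchange_big/=; apply: eq_bigr => k _.
  by rewrite mxE mulr_suml; apply: eq_bigr => l _; rewrite mulrA.
apply: cvg_big => [|l _]; first exact: add_continuous.
by apply: cvgMr; exact: cvg_expmx.
Qed.

End MatrixExponential.

(** Induction gives [A ^+ k *m V = V *m B ^+ k], so both sides are limits of one and the same
    series. *)
Lemma expmx_intertwine (R : realType) n m (A : 'M[R]_n) (B : 'M[R]_m) (V : 'M[R]_(n, m)) :
  A *m V = V *m B -> expmx A *m V = V *m expmx B.
Proof.
move=> AV.
have AkV k : A ^+ k *m V = V *m B ^+ k.
  elim: k => [|k IH]; first by rewrite !expr0 mul1mx mulmx1.
  by rewrite !exprSr -!mulmxE -mulmxA AV !mulmxA IH.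
apply/matrixP => i j; apply: (cvg_unique _ (cvg_expmx_mulmx _ _ _ A V i j)) => //.
under [X in series X]eq_fun do rewrite AkV.
exact: cvg_mulmx_expmx.
Qed.

(** * Differentiation of the matrix exponential in its time parameter *)

Section MatrixExponentialDerivative.
Variables (R : realType) (n : nat).
Implicit Types (A : 'M[R]_n) (x : R) (i j : 'I_n).

Lemma mx_exprZn A x k : (x *: A) ^+ k = x ^+ k *: A ^+ k.
Proof.
elim: k => [|k IH]; first by rewrite !expr0 scale1r.
by rewrite !exprS IH -!mulmxE -scalemxAl -scalemxAr scalerA.
Qed.

(** Power-series coefficients in [x] of an entry of [expmx (x *: A) *m A ^+ m]; the shift [m] turns
    termwise differentiation into the passage from [m] to [m.+1]. *)
Let c A i j m k := (A ^+ (k + m)) i j / k`!%:R.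

Let pseries_c A i j m x :
  pseries (c A i j m) x @ \oo --> (expmx (x *: A) *m A ^+ m) i j.
Proof.
rewrite (_ : pseries _ _ =
  series (fun k => ((x *: A) ^+ k *m A ^+ m) i j / k`!%:R)).
  exact: cvg_expmx_mulmx.
congr series; apply/funext => k.
by rewrite /c /= mx_exprZn -scalemxAl [in RHS]mxE mulmxE -exprD mulrC mulrA.
Qed.

Let diffs_c A i j m : pseries_diffs (c A i j m) = c A i j m.+1.
Proof.
apply/funext => k; rewrite /pseries_diffs /c addSnnS factS natrM invfM.
by rewrite mulrCA mulVKf.
Qed.

Lemma is_derive_expmx A i j x : is_derive x (1 : R)
  (fun y => expmx (y *: A) i j) ((expmx (x *: A) *m A) i j).
Proof.
rewrite (_ : (fun y => _) = fun y => limn (pseries (c A i j 0) y)); last first.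
  apply/funext => y; apply/esym/cvg_lim => //.
  by have := pseries_c A i j 0%N y; rewrite expr0 mulmx1.
have <- : limn (pseries (pseries_diffs (c A i j 0)) x) = (expmx (x *: A) *m A) i j.
  by apply: cvg_lim => //; rewrite diffs_c; exact: pseries_c.
(* Any point beyond [|x|] serves, since the series and its first two formal derivatives converge
   everywhere. *)
apply: (@pseries_snd_diffs R _ (`|x| + 1)); rewrite ?diffs_c;
  try by apply/cvg_ex; eexists; exact: pseries_c.
by rewrite [ltRHS]ger0_norm ?addr_ge0// ltrDl.
Qed.

Lemma continuous_expmx A i j : continuous (fun x => expmx (x *: A) i j).
Proof.
move=> x; apply/differentiable_continuous/derivable1_diffP.
by have [] := is_derive_expmx A i j x.
Qed.

Lemma continuous_expmx_mul m A (V : 'M[R]_(n, m)) i (j : 'I_m) :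
  continuous (fun x => (expmx (x *: A) *m V) i j).
Proof.
under eq_fun do rewrite mxE.
move=> x; apply: cvg_big => [|l _]; first exact: add_continuous.
by apply: cvgMl; exact: continuous_expmx.
Qed.

(** The zero row is inherited by every positive power of [A], so only the term [k = 0] survives. *)
Lemma expmx_absorbing A i j x : row i A = 0 ->
  expmx (x *: A) i j = (i == j)%:R.
Proof.
move=> Ai0; apply: (cvg_unique _ (cvg_expmx _ _ _ i j)) => //.
have Aik k : ((x *: A) ^+ k.+1) i j = 0.
  rewrite mx_exprZn (exprS A) -mulmxE !mxE big1 ?mulr0//.
  by move=> l _; move/rowP: Ai0 => /(_ l); rewrite !mxE => ->; rewrite mul0r.
apply: cvg_near_cst; near=> N.
(* The empty partial sum lacks the identity term, hence the restriction to positive [N]. *)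
have N0 : (0 < N)%N by near: N; exact: nbhs_infty_gt.
rewrite /series/= -(prednK N0) big_nat_recl// expr0 mxE divr1.
by rewrite big1 ?addr0// => k _; rewrite Aik mul0r.
Unshelve. all: by end_near. Qed.
End MatrixExponentialDerivative.

(** * Measures given by a density, and recovery of a density from a distribution function *)

Section DensityMeasure.
Context d (X : measurableType d) (R : realType)
  (mu : {measure set X -> \bar R}) (f : X -> R).
Hypotheses (f_ge0 : forall x, 0 <= f x) (mf : measurable_fun setT f).

(** The two proofs are arguments so that the measure structure declared below can be inferred from
    the term. *)
Definition density_measure of (forall x, 0 <= f x) & measurable_fun setT f :=
  fun A => (\int[mu]_(x in A) (f x)%:E)%E.

Local Notation nu := (density_measure f_ge0 mf).

Let nu0 : nu set0 = 0%E.
Proof. by rewrite /nu integral_set0. Qed.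

Let nu_ge0 A : (0 <= nu A)%E.
Proof. by apply: integral_ge0 => x _; rewrite lee_fin. Qed.

Let nu_sigma_additive : semi_sigma_additive nu.
Proof.
move=> /= F mF tF mUF; rewrite /nu; apply: cvg_toP.
  apply: ereal_nondecreasing_is_cvgn => m n mn.
  by apply: lee_sum_nneg_natr => // k _ _; exact: nu_ge0.
rewrite ge0_integral_bigcup//=.
- by apply/measurable_EFinP; exact: measurable_funTS.
- by move=> x _; rewrite lee_fin.
Qed.

HB.instance Definition _ := isMeasure.Build _ _ _
  nu nu0 nu_ge0 nu_sigma_additive.
End DensityMeasure.
Arguments density_measure {d X R} mu {f}.

Section DensityOfCdf.
Variable R : realType.
Local Notation leb := (@lebesgue_measure R).

Lemma itv_infty_c_generate :
  @measurable _ (measurableTypeR R) = <<s [set `]-oo, x]%classic | x in [set: R]] >>.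
Proof.
rewrite [LHS]RGenOInfty.measurableE eqEsubset; split.
  apply: smallest_sub; first exact: smallest_sigma_algebra.
  move=> _ [x ->]; rewrite -setCitvl; apply: sigma_algebraC.
  by apply: sub_sigma_algebra; exists x.
apply: smallest_sub; first exact: smallest_sigma_algebra.
move=> _ [x _ <-]; rewrite -setCitvr; apply: sigma_algebraC.
by apply: sub_sigma_algebra; exists x.
Qed.

Variables (mu : {measure set (measurableTypeR R) -> \bar R}) (F f : R -> R).
Hypotheses (F_derive : forall x, is_derive x (1 : R) F (f x))
  (f_cont : continuous f) (f_ge0 : forall x : R, 0 <= x -> 0 <= f x)
  (F0 : F 0 = 0) (mu_cdf : forall x : R, 0 <= x -> mu `]-oo, x]%classic = (F x)%:E).

Let F_cont : continuous F.
Proof.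
move=> x; apply/differentiable_continuous/derivable1_diffP.
by have [] := F_derive x.
Qed.

Lemma integral_FTC0 (x : R) : 0 <= x ->
  (\int[leb]_(y in `[0%R, x]) (f y)%:E = (F x)%:E)%E.
Proof.
rewrite le_eqVlt => /predU1P[<-|x0].
  by rewrite set_itv1 integral_set1 F0.
rewrite (@continuous_FTC2 _ f F)//.
- by rewrite F0 sube0.
- exact: continuous_subspaceT.
- split => [y _||]; first by have [] := F_derive y.
  + by apply/cvg_at_right_filter; exact: F_cont.
  + by apply/cvg_at_left_filter; exact: F_cont.
- by move=> y _; rewrite derive1E; have [] := F_derive y.
Qed.

(** Closed left rays are stable under intersection and generate the Borel sets; two measures that
    agree on them, with finite values on rays exhausting the line, coincide. On a ray the agreement
    is the fundamental theorem of calculus. *)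
Lemma measure_density_of_cdf (B : set R) : measurable B -> B `<=` `[0, +oo[ ->
  mu B = (\int[leb]_(x in B) (f x)%:E)%E.
Proof.
move=> mB B0.
(* The sign of [f] is known only on the half-line; the cut-off makes it the density of a measure on
   the whole line. *)
pose g : R -> R := f \_ `[0, +oo[.
have g_ge0 x : 0 <= g x.
  by rewrite /g patchE; case: ifPn => //; rewrite inE/= in_itv/= andbT => /f_ge0.
have mg : measurable_fun setT g.
  apply/(measurable_restrictT _ _).1 => //.
  by apply: measurable_funTS; exact: continuous_measurable_fun.
have gE (A : set R) : measurable A -> A `<=` `[0%R, +oo[ ->
    (\int[leb]_(x in A) (g x)%:E = \int[leb]_(x in A) (f x)%:E)%E.
  move=> mA A0; apply: eq_integral => x; rewrite inE => /A0 x0.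
  by rewrite /g patchE mem_set.
rewrite -gE//.
pose nu : {measure set (measurableTypeR R) -> \bar R} :=
  density_measure (X := measurableTypeR R) leb g_ge0 mg.
have <- : nu B = (\int[leb]_(x in B) (g x)%:E)%E by [].
apply: (@measure_unique _ R (measurableTypeR R)
  [set `]-oo, x]%classic | x in [set: R]]
  (fun n => `]-oo, n%:R]%classic) _ _ _ _ mu nu _ _ B mB) => //.
- exact: itv_infty_c_generate.
- move=> _ _ [x _ <-] [y _ <-]; exists (Num.min x y) => //.
  by apply/seteqP; split => z /=; rewrite !in_itv/= le_min => /andP.
- apply/seteqP; split => // x _; exists (Num.truncn `|x|).+1 => //=.
  by rewrite in_itv/= (le_trans (ler_norm _))// ltW// truncnS_gt.
- move=> _ [x _ <-]; rewrite /nu /= /density_measure.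
  have int0 : (\int[leb]_(y in `]-oo, 0%R[) (g y)%:E = 0)%E.
    apply: integral0_eq => y; rewrite /= in_itv/= => y0.
    by rewrite /g patchE memNset//= in_itv/= andbT leNgt y0.
  have [x0|x0] := ltP x 0.
    (* Both sides vanish on a negative ray: [F 0 = 0] leaves [mu] no mass on the ray up to 0. *)
    transitivity (0 : \bar R)%E.
      apply/eqP; rewrite eq_le measure_ge0 andbT.
      rewrite (_ : 0%E = mu `]-oo, (0 : R)]%classic); last by rewrite mu_cdf// F0.
      by apply: le_measure; rewrite ?inE//; apply: subset_itvl; exact: ltW.
    apply/esym/integral0_eq => y; rewrite /= in_itv/= => yx.
    by rewrite /g patchE memNset//= in_itv/= andbT leNgt (le_lt_trans yx).
  rewrite mu_cdf// -integral_FTC0// -gE//; last exact: subset_itvl.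
  rewrite (_ : `]-oo, x]%classic = `]-oo, 0[ `|` `[0, x]); last first.
    by rewrite -itv_bndbnd_setU// bnd_simp.
  rewrite ge0_integral_setU//=.
  + by rewrite int0 add0e.
  + by apply/measurable_EFinP; exact: measurable_funTS.
  + by move=> y _; rewrite lee_fin.
  + rewrite disj_set2E; apply/eqP/seteqP; split => // y []/=.
    by rewrite !in_itv/= => y0 /andP[]; rewrite leNgt y0.
- by move=> n; rewrite mu_cdf ?ltry.
Qed.

(** Since [f] is nonnegative on the half-line, the integral of its absolute value is the [mu]-mass
    of the half-line. *)
Lemma integrable_density_of_cdf : (mu setT < +oo)%E ->
  leb.-integrable `[0, +oo[ (EFin \o f).
Proof.
move=> muT; apply/integrableP; split.
  apply/measurable_EFinP; apply: measurable_funTS.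
  exact: continuous_measurable_fun.
have -> : (\int[leb]_(x in `[0%R, +oo[) `|(EFin \o f) x| =
           \int[leb]_(x in `[0%R, +oo[) (f x)%:E)%E.
  apply: eq_integral => x; rewrite inE/= in_itv/= andbT => x0.
  by rewrite ger0_norm ?f_ge0.
rewrite -measure_density_of_cdf//; apply: le_lt_trans muT.
by apply: le_measure; rewrite ?inE.
Qed.
End DensityOfCdf.

(** * The exit time of a right-continuous path: attainment and measurability *)

Section ExitTime.
Context (R : realType) (p : nat) (d : measure_display) (Omega : measurableType d).
Variable phi : R -> Omega -> state p.
Hypotheses (phi_measurable : forall t x, measurable [set w | phi t w = x])
  (phi_rcont : forall w t, 0 <= t ->
    exists2 e : R, 0 < e & forall u, t <= u < t + e -> phi u w = phi t w).

Local Notation tau := (exit_time phi).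

(** Right-continuity holds the state for a positive time, which contains a rational. Events over
    uncountably many times are thus reduced to countable ones. *)
Lemma rational_visit w t y : 0 <= t -> t < y ->
  exists q : rat, t < ratr q < y /\ phi (ratr q) w = phi t w.
Proof.
move=> t0 ty; have [e e0 phie] := phi_rcont w t t0.
have [q] : exists q : rat, ratr q \in `]t, Num.min y (t + e)[.
  by apply: rat_in_itvoo; rewrite lt_min ty ltrDl.
rewrite in_itv/= lt_min => /and3P[tq qy qe]; exists q; rewrite tq qy; split=> //.
by rewrite phie// ltW.
Qed.

Let exits w := [set x | 0 <= x /\ ~~ inEoa (phi x w)].

Let exits_lbound w : has_lbound (exits w).
Proof. by exists 0 => x []. Qed.

Lemma exit_time_le w t : 0 <= t -> ~~ inEoa (phi t w) -> tau w <= t.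
Proof. by move=> t0 phit; exact: (ge_inf (exits_lbound w)). Qed.

Lemma exit_time_ge0 w : 0 <= tau w.
Proof.
have [[x Hx]|/set0P/negP/negPn/eqP H] := pselect (exits w !=set0).
  by apply: lb_le_inf => [|y []//]; exists x.
by rewrite /exit_time -/(exits w) H inf0.
Qed.

(** Some exit time lies so close to the right of the infimum that right-continuity gives the path
    the same state at both. *)
Lemma exit_time_attained w t : 0 <= t -> ~~ inEoa (phi t w) ->
  ~~ inEoa (phi (tau w) w).
Proof.
move=> t0 phit; have [e e0 phie] := phi_rcont w _ (exit_time_ge0 w).
have [|x [x0 phix] xe] := @inf_adherent R (exits w) e e0.
  by split => //; exists t.
by rewrite -(phie x)// xe andbT; exact: exit_time_le.
Qed.

Lemma measurable_state_pred (A : pred (state p)) t :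
  measurable [set w | A (phi t w)].
Proof.
rewrite (_ : [set _ | _] = \bigcup_(x in [set x | A x]) [set w | phi t w = x]).
  by apply: fin_bigcup_measurable => //; exact: finite_finset.
by apply/seteqP; split => w /= => [Aw|[x Ax ->]//]; exists (phi t w).
Qed.

(* A path that never exits has [tau = inf set0 = 0], hence the complement below. *)
Lemma measurable_exit_time : measurable_fun setT tau.
Proof.
apply: (measurability (@RGenInftyO.G R)) => [|_ [_ [x ->] <-]].
  exact: RGenInftyO.measurableE.
rewrite setTI; have [x0|x0] := leP x 0.
  rewrite (_ : _ @^-1` _ = set0)// -subset0 => w /=.
  by rewrite in_itv/= ltNge (le_trans x0)// exit_time_ge0.
pose E (A : set rat) := \bigcup_(q in A) [set w | ~~ inEoa (phi (ratr q) w)].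
have mE A : measurable (E A).
  rewrite /E bigcup_mkcond; apply: bigcupT_measurable_rat => q.
  case: ifPn => _ //.
  exact: (measurable_state_pred [pred x | ~~ inEoa x]).
have -> : tau @^-1` `]-oo, x[%classic =
    ~` E [set q | 0 <= (ratr q : R)] `|` E [set q | 0 <= (ratr q : R) < x]; last first.
  by apply: measurableU => //; exact: measurableC.
apply/seteqP; split => w /=; rewrite in_itv/=.
- move=> tx; have [[q q0 phiq]|] := pselect (E [set q | 0 <= (ratr q : R)] w).
    (* The path does exit, so [tau] is itself an exit time, and its state recurs at a rational time
       before [x]. *)
    right; have [r [/andP[tr rx] phir]] := rational_visit w _ _ (exit_time_ge0 w) tx.
    exists r; first by rewrite /= rx (le_trans (exit_time_ge0 w))// ltW.
    by rewrite /= phir; exact: exit_time_attained phiq.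
  by left.
- move=> [nE|[q /andP[q0 qx] phiq]]; last first.
    by rewrite (le_lt_trans _ qx)// exit_time_le.
  rewrite /exit_time (_ : [set _ | _] = set0) ?inf0// -subset0 => t [t0 phit].
  apply: nE; have [|q [/andP[tq _] phiq]] := rational_visit w t (t + 1) t0.
    by rewrite ltrDl.
  by exists q; rewrite /= ?phiq// (le_trans t0)// ltW.
Qed.

Lemma measurable_state_at_exit D : measurable [set w | phi (tau w) w = D].
Proof.
have mtau A : measurable A -> measurable (tau @^-1` A).
  by move=> mA; rewrite -[_ @^-1` _]setTI; exact: measurable_exit_time.
(* [phi] takes the value [phi tau] at all rational times in [(tau, tau + 1/n.+1)]
   for some [n], and right-continuity recovers [phi tau] from them. *)
rewrite (_ : [set _ | _] = \bigcup_n \bigcap_(q in [set: rat])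
  ((tau @^-1` `[ratr q, +oo[) `|` (tau @^-1` `]-oo, ratr q - n.+1%:R^-1]) `|`
   [set w | phi (ratr q) w = D])).
  apply: bigcupT_measurable => n; rewrite -[X in measurable X]setCK setC_bigcap.
  apply: measurableC; apply: bigcupT_measurable_rat => q; apply: measurableC.
  by apply: measurableU => //; apply: measurableU; apply: mtau.
apply/seteqP; split => w /=.
- move=> <-; have [e e0 phie] := phi_rcont w _ (exit_time_ge0 w).
  have [n ne] : exists n, n.+1%:R^-1 < e.
    exists (Num.truncn e^-1); rewrite invf_plt ?posrE//.
    exact: truncnS_gt.
  exists n => // q _ /=; rewrite !in_itv/= andbT.
  have [|tq] := leP (ratr q) (tau w); first by left; left.
  have [|qt] := leP (tau w) (ratr q - n.+1%:R^-1); first by left; right.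
  right; apply: phie; rewrite ltW//=.
  by move: qt; rewrite ltrBlDr => /lt_trans; apply; rewrite ltrD2l.
- move=> [n _ H]; have [|q [/andP[tq qt] <-]] :=
      rational_visit w _ (tau w + n.+1%:R^-1) (exit_time_ge0 w).
    by rewrite ltrDl invr_gt0.
  have /= := H q I; rewrite !in_itv/= andbT => -[[]|//].
    by rewrite leNgt tq.
  by rewrite lerBrDr leNgt qt.
Qed.
End ExitTime.

(** The index type is enumerated through [pickle]; integers that decode to nothing contribute the
    empty set. *)
Lemma negligible_bigcup_countType d (X : measurableType d) (R : realType)
    (mu : {measure set X -> \bar R}) (I : countType) (F : I -> set X) :
  (forall i, mu.-negligible (F i)) -> mu.-negligible (\bigcup_i F i).
Proof.
move=> F0; apply: (@negligibleS _ _ _ _ (\bigcup_n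
    (if unpickle n is Some i then F i else set0))).
  by move=> x [i _ Fix]; exists (pickle i); rewrite ?pickleK.
apply: negligible_bigcup => n; case: unpickle => //.
exact: negligible_set0.
Qed.

(** * The joint law of the exit time and the exit state *)

Section AbsorptionLaw.
Context (R : realType) (p : nat) (Q : 'M[R]_((p + p) + ((1 + 1) + 1))).
Context (d : measure_display) (Omega : measurableType d).
Variables (P : state p -> probability Omega R) (phi : R -> Omega -> state p).
Hypothesis markov : markov_family Q P phi.

Let phi_measurable t x : measurable [set w | phi t w = x].
Proof. by have [+ _ _] := markov; apply. Qed.

Let phi_rcont w t : 0 <= t ->
  exists2 e : R, 0 < e & forall u, t <= u < t + e -> phi u w = phi t w.
Proof. by have [_ + _] := markov; apply. Qed.

Local Notation tau := (exit_time phi).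

Lemma markov_start j : P j [set w | phi 0 w = j] = 1%E.
Proof.
have [_ _ fdd] := markov.
have := fdd j 0%N (fun=> 0) (fun=> j) erefl (fun=> lexx _).
rewrite big_ord0 eqxx mulr1 => <-; congr (P j _).
by apply/seteqP; split => w /= => [|/(_ 0%N)]; [move=> -> k | apply].
Qed.

(** The start event has probability one. The joint laws in [markov_family] always include time 0, so
    laws at other times are read off after this intersection. *)
Lemma markov_startI j (A : set Omega) : measurable A ->
  P j A = P j ([set w | phi 0 w = j] `&` A).
Proof.
move=> mA; rewrite (measureDI (P j) mA (phi_measurable 0 j)) setIC.
rewrite [X in (X + _)%E](_ : _ = 0%E) ?add0e//.
apply/eqP; rewrite eq_le measure_ge0 andbT.
rewrite (_ : 0%E = P j (~` [set w | phi 0 w = j])).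
  apply: le_measure; rewrite ?inE; [exact: measurableD|exact: measurableC|].
  by move=> w [].
by rewrite probability_setC// markov_start subee.
Qed.

Lemma markov_law j x t : 0 <= t ->
  P j [set w | phi t w = x] = (expmx (t *: Q) j x)%:E.
Proof.
move=> t0; rewrite markov_startI//; have [_ _ fdd] := markov.
have := fdd j 1%N (fun k => if k is 0%N then 0 else t)
  (fun k => if k is 0%N then j else x) erefl.
rewrite big_ord1/= eqxx mul1r subr0 => <-; last by case.
congr (P j _); apply/seteqP; split => w /=.
  by move=> [w0 wt] [|k].
by move=> H; split; [exact: (H 0%N)|exact: (H 1%N)].
Qed.

(** By [markov_law] the entry is a probability. *)
Lemma expmx_generator_ge0 j x t : 0 <= t -> 0 <= expmx (t *: Q) j x.
Proof. by move=> t0; rewrite -lee_fin -markov_law. Qed.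

Lemma expmx_generator0 j x : j != x -> expmx (0 *: Q) j x = 0.
Proof.
move=> jx; apply: EFin_inj; rewrite -markov_law// markov_startI//.
rewrite (_ : _ `&` _ = set0) ?measure0// -subset0 => w /= [-> jx'].
by rewrite jx' eqxx in jx.
Qed.

(** In the joint law at times 0, [a], [b] the last factor is 1, because row [x] of [Q] vanishes.
    Hence being at [x] at both times is as likely as being there at time [a], and cancelling this
    finite mass leaves 0. *)
Lemma markov_absorbed j x a b : row x Q = 0 -> 0 <= a -> a <= b ->
  P j [set w | phi a w = x /\ phi b w <> x] = 0%E.
Proof.
move=> Qx a0 ab.
have mab : measurable [set w | phi a w = x /\ phi b w = x].
  exact: (measurableI _ _ (phi_measurable a x) (phi_measurable b x)).
have Pab : P j [set w | phi a w = x /\ phi b w = x] =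
           P j [set w | phi a w = x].
  rewrite markov_startI// markov_law//; have [_ _ fdd] := markov.
  have := fdd j 2%N (fun k => match k with 0%N => 0 | 1%N => a | _ => b end)
    (fun k => if k is 0%N then j else x) erefl.
  rewrite !big_ord_recl big_ord0/= eqxx mul1r subr0 mulr1.
  rewrite (expmx_absorbing _ _ Q x x _ Qx) eqxx mulr1 => <-; last by case=> [|[]].
  congr (P j _); apply/seteqP; split => w /=.
    by move=> [w0 [wa wb]] [|[|k]].
  by move=> H; split; [exact: (H 0%N)|split; [exact: (H 1%N)|exact: (H 2%N)]].
have : P j [set w | phi a w = x] =
    (P j [set w | phi a w = x /\ phi b w <> x] + P j [set w | phi a w = x])%E.
  rewrite -{2}Pab.
  exact: (measureDI (P j) (phi_measurable a x) (phi_measurable b x)).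
move/(congr1 (fun e => e - P j [set w | phi a w = x]))%E.
by rewrite subee ?fin_num_measure// addeK ?fin_num_measure// => <-.
Qed.

Hypothesis Q_absorbing : forall x, ~~ inEoa x -> row x Q = 0.

(** Absorption is known almost surely for each fixed pair of times. A countable union yields a
    single null set off which every exit state reached before [t] is still occupied at [t]; there
    the event on the left agrees with [phi t w = D]. *)
Lemma exit_law j D t : 0 <= t -> ~~ inEoa D ->
  P j [set w | tau w <= t /\ phi (tau w) w = D] = (expmx (t *: Q) j D)%:E.
Proof.
move=> t0 exitD; rewrite -markov_law//.
(* The paths that have left, by time [t], an absorbing state occupied at an
   earlier rational time. *)
pose Z (c : rat * state p) := [set w | [/\ 0 <= (ratr c.1 : R) <= t,
  ~~ inEoa c.2, phi (ratr c.1) w = c.2 & phi t w <> c.2]].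
have Z0 c : (P j).-negligible (Z c).
  case: c => q x; have [qt|qt] := boolP (0 <= (ratr q : R) <= t); last first.
    by apply: (@negligibleS _ _ _ _ set0); [move=> w []; rewrite (negbTE qt)|
      exact: negligible_set0].
  have [xE|xE] := boolP (inEoa x).
    by apply: (@negligibleS _ _ _ _ set0); [move=> w []; rewrite xE|
      exact: negligible_set0].
  apply: (@negligibleS _ _ _ _ [set w | phi (ratr q) w = x /\ phi t w <> x]).
    by move=> w [].
  have /andP[q0 qle] := qt.
  apply/negligibleP; last exact: (markov_absorbed _ _ _ _ (Q_absorbing x xE)).
  exact: (measurableD (phi_measurable (ratr q) x) (phi_measurable t x)).
have [N [mN N0 ZN]] := negligible_bigcup_countType _ _ _ (P j) _ Z Z0.
(* The time [s] may be irrational; a rational time in []s, t[] with the same state puts an offending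
   path into some [Z (q, phi s w)]. *)
have visited w s : ~ N w -> 0 <= s -> s <= t -> ~~ inEoa (phi s w) ->
    phi t w = phi s w.
  move=> Nw s0; rewrite le_eqVlt => /predU1P[->//|st] exit_s.
  apply: contra_notP Nw => phi_ts; apply: ZN.
  have [q [/andP[sq qt] phiq]] :=
    rational_visit _ _ _ _ phi phi_rcont w s t s0 st.
  exists (q, phi s w) => //; split => //=.
  by rewrite (le_trans s0) ?ltW.
have mA : measurable [set w | tau w <= t /\ phi (tau w) w = D].
  have mtau := measurable_exit_time _ _ _ _ phi phi_measurable phi_rcont
    measurableT `]-oo, t]%classic (measurable_itv _).
  have := measurableI _ _ mtau
    (measurable_state_at_exit _ _ _ _ phi phi_measurable phi_rcont D).
  by rewrite setTI.
have le_modN (A B : set Omega) : measurable A -> measurable B ->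
    A `<=` B `|` N -> (P j A <= P j B)%E.
  move=> mA' mB AB; rewrite -(measureU0 mB mN N0).
  by apply: le_measure; rewrite ?inE//; exact: measurableU.
apply/eqP; rewrite eq_le; apply/andP; split; apply: le_modN => //.
- move=> w [taut phiD]; have [|Nw] := pselect (N w); [by right|left => /=].
  rewrite (visited w (tau w))//; first exact: exit_time_ge0.
  by rewrite phiD.
- move=> w phiD; have [|Nw] := pselect (N w); [by right|left => /=].
  have exit_t : ~~ inEoa (phi t w) by rewrite phiD.
  have taut := exit_time_le _ _ _ _ phi w t t0 exit_t.
  split => //; rewrite -(visited w (tau w))//; first exact: exit_time_ge0.
  exact: exit_time_attained exit_t.
Qed.

Section ExitDensity.
Variables (j D : state p).
Hypotheses (jD : j != D) (exitD : ~~ inEoa D) (QD_ge0 : forall k, 0 <= Q k D).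

(** The measure is the image under [tau] of [P j] restricted to the event that the exit state is
    [D]. *)
Let exit_measureP : exists mu : {measure set (measurableTypeR R) -> \bar R},
  forall A : set R, mu A = P j [set w | A (tau w) /\ phi (tau w) w = D].
Proof.
have mD := measurable_state_at_exit _ _ _ _ phi phi_measurable phi_rcont D.
unshelve eexists (pushforward (T2 := measurableTypeR R) (mrestr (P j) mD) tau
  : {measure set (measurableTypeR R) -> \bar R}) => //.
exact: measurable_exit_time.
Qed.

Let exit_cdf_derive (x : R) : is_derive x (1 : R)
  (fun y => expmx (y *: Q) j D) ((expmx (x *: Q) *m Q) j D).
Proof. exact: is_derive_expmx. Qed.

Let exit_density_continuous : continuous (fun x : R => (expmx (x *: Q) *m Q) j D).
Proof. exact: continuous_expmx_mul. Qed.

(** Each summand is a transition probability times a nonnegative entry of column [D]. *)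
Let exit_density_ge0 (x : R) : 0 <= x -> 0 <= (expmx (x *: Q) *m Q) j D.
Proof.
by move=> x0; rewrite mxE sumr_ge0// => k _; rewrite mulr_ge0 ?expmx_generator_ge0.
Qed.

Lemma exit_density (B : set R) : measurable B -> B `<=` `[0, +oo[ ->
  P j [set w | B (tau w) /\ phi (tau w) w = D] =
  (\int[lebesgue_measure]_(x in B) ((expmx (x *: Q) *m Q) j D)%:E)%E.
Proof.
have [mu muE] := exit_measureP; rewrite -muE; apply: measure_density_of_cdf => //.
(* As [j != D], the distribution function vanishes at 0: there is no atom at time 0. *)
- exact: expmx_generator0.
- by move=> x x0; rewrite muE -exit_law.
Qed.

Lemma integrable_exit_density : lebesgue_measure.-integrable `[0%R, +oo[
  (EFin \o (fun x : R => (expmx (x *: Q) *m Q) j D)).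
Proof.
have [mu muE] := exit_measureP.
apply: (integrable_density_of_cdf _ mu (fun y => expmx (y *: Q) j D)) => //.
- exact: expmx_generator0.
- by move=> x x0; rewrite muE -exit_law.
- rewrite muE (le_lt_trans (probability_le1 _ _)) ?ltry//.
  apply: (measurableI _ _ measurableT).
  exact: measurable_state_at_exit.
Qed.
End ExitDensity.
End AbsorptionLaw.

(** * Action of the generator on antisymmetric vectors *)

Lemma max0_sub_maxN (R : realDomainType) (x : R) :
  Num.max 0 x - Num.max 0 (- x) = x.
Proof.
have [x0|x0] := leP 0 x; first by rewrite max_l ?subr0// oppr_le0.
by rewrite max_r ?sub0r ?opprK// oppr_ge0 ltW.
Qed.

Section Generator.
Context (R : realType) (p : nat) (T : 'M[R]_p) (s : 'cV[R]_p) (lam : R).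
Local Notation Q := (Qgen T s lam).

Lemma TplusBTminus : Tplus T - Tminus T = T.
Proof.
apply/matrixP => i j; rewrite !mxE; case: eqVneq => [->|_]; first by rewrite subr0.
exact: max0_sub_maxN.
Qed.

Lemma splusBsminus : splus s - sminus s = s.
Proof.
apply/matrixP => i j; rewrite !mxE (ord1 j).
exact: max0_sub_maxN.
Qed.

(* Original and anti-states carry opposite signs: [M] acts on vectors of the
   form [(u; -u)] as [T - lam I] acts on [u]. *)
Definition antisym_mx : 'M[R]_(p + p, p) := col_mx 1%:M (- 1%:M).

Lemma Mblock_antisym x : (x *: Mblock T lam) *m antisym_mx =
  antisym_mx *m (x *: (T - lam%:M)).
Proof.
rewrite -scalemxAl -scalemxAr; congr (_ *: _).
rewrite /Mblock /antisym_mx mul_block_col mul_col_mx !mulmxN !mulmx1 mulNmx !mul1mx.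
have E : Tplus T - lam%:M - Tminus T = T - lam%:M by rewrite addrAC TplusBTminus.
by rewrite E -[Tminus T - _]opprB E.
Qed.

(** Extending by zero on the absorbing states and the cemetery carries the intertwining relation
    from [Mblock] to the whole generator. *)
Definition antisym_state_mx : 'M[R]_(p + p + (1 + 1 + 1), p) := col_mx antisym_mx 0.

Lemma Qgen_antisym x : (x *: Q) *m antisym_state_mx =
  antisym_state_mx *m (x *: (T - lam%:M)).
Proof.
rewrite /Qgen scale_block_mx /antisym_state_mx mul_block_col mul_col_mx.
by rewrite Mblock_antisym !mulmx0 !scaler0 !mul0mx !addr0.
Qed.

Lemma antisym_mul : antisym_mx *m s = col_mx s (- s).
Proof. by rewrite mul_col_mx mulNmx !mul1mx. Qed.

(** The two exit columns are [(splus; sminus; 0)] and [(sminus; splus; 0)], and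
    [splus - sminus = s]. *)
Lemma Qgen_exit k : Q k (sDeltaO p) - Q k (sDeltaA p) = (antisym_state_mx *m s) k 0.
Proof.
rewrite mul_col_mx antisym_mul mul0mx /Qgen.
have [a ->|b ->] := split_ordP k; last by rewrite !block_mxEdr col_mxEd !mxE subr0.
rewrite !block_mxEur !row_mxEl row_mxEr col_mxEu.
have [i ->|i ->] := split_ordP a; rewrite ?col_mxEu ?col_mxEd -[in RHS]splusBsminus.
  by rewrite [in RHS]mxE [X in _ = _ + X]mxE.
by rewrite opprB [in RHS]mxE [X in _ = _ + X]mxE.
Qed.

Lemma Qgen_exit_ge0 k : 0 <= Q k (sDeltaO p) /\ 0 <= Q k (sDeltaA p).
Proof.
rewrite /Qgen; have [a ->|b ->] := split_ordP k; last by rewrite !block_mxEdr !mxE.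
rewrite !block_mxEur !row_mxEl row_mxEr.
by have [i ->|i ->] := split_ordP a;
  rewrite ?col_mxEu ?col_mxEd !mxE !le_max !lexx.
Qed.

Lemma Qgen_absorbing k : ~~ inEoa k -> row k Q = 0.
Proof.
have [a ->|b -> _] := split_ordP k; first by rewrite /inEoa /= ltn_ord.
by apply/rowP => l; rewrite mxE; have [a ->|c ->] := split_ordP l;
  rewrite ?block_mxEdl ?block_mxEdr !mxE.
Qed.

(** The difference is [expmx (x *: Q)] applied to the antisymmetric lift of [s]; intertwining
    carries the exponential across the lift. *)
Lemma exit_density_diff j x :
  (expmx (x *: Q) *m Q) j (sDeltaO p) - (expmx (x *: Q) *m Q) j (sDeltaA p) =
  (antisym_state_mx *m (expmx (x *: (T - lam%:M)) *m s)) j 0.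
Proof.
rewrite mulmxA -(expmx_intertwine _ _ _ _ _ _ (Qgen_antisym x)) -mulmxA.
rewrite !mxE -sumrB; apply: eq_bigr => k _.
by rewrite -mulrBr Qgen_exit.
Qed.
End Generator.

(** * Densities of the signed exit measures *)

Theorem theorem3p1 (R : realType) (p : nat) (T : 'M[R]_p) (s : 'cV[R]_p)
  (lam : R) (hlam : lambda0 T s <= lam)
  (d : measure_display) (Omega : measurableType d)
  (P : state p -> probability Omega R) (phi : R -> Omega -> state p)
  (hmark : markov_family (Qgen T s lam) P phi)
  (htrans : forall j : state p, inEoa j -> transient_state P phi j)
  (i : 'I_p) :
  let fo := fun x : R => (expmx (x *: (T - lam%:M)) *m s) i 0 in
  let fa := fun x : R => - (expmx (x *: (T - lam%:M)) *m s) i 0 in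
  [/\ ((forall x, 0 <= x ->
         fo x = (row_mx (delta_mx 0 i) (0 : 'rV[R]_p)
                   *m expmx (x *: Mblock T lam) *m col_mx s (- s)) 0 0) /\
      (forall x, 0 <= x ->
         fa x = (row_mx (0 : 'rV[R]_p) (delta_mx 0 i)
                   *m expmx (x *: Mblock T lam) *m col_mx s (- s)) 0 0)),
      lebesgue_measure.-integrable `[0, +oo[ (EFin \o fo),
      lebesgue_measure.-integrable `[0, +oo[ (EFin \o fa),
      (forall B : set R, measurable B -> B `<=` `[0, +oo[ ->
         exit_signed_measure P phi (sOrig i) B = Rintegral lebesgue_measure B fo) &
      (forall B : set R, measurable B -> B `<=` `[0, +oo[ ->
         exit_signed_measure P phi (sAnti i) B = Rintegral lebesgue_measure B fa)].
Proof.
move=> fo fa.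
have blockE x : expmx (x *: Mblock T lam) *m col_mx s (- s) =
    antisym_mx R p *m (expmx (x *: (T - lam%:M)) *m s).
  rewrite -antisym_mul mulmxA.
  by rewrite (expmx_intertwine _ _ _ _ _ _ (Mblock_antisym _ _ T lam x)) mulmxA.
pose g j D x := (expmx (x *: Qgen T s lam) *m Qgen T s lam) j D.
have exitO : ~~ inEoa (sDeltaO p) by rewrite /inEoa /= -leqNgt leq_addr.
have exitA : ~~ inEoa (sDeltaA p) by rewrite /inEoa /= -leqNgt leq_addr.
have alive j D : inEoa j -> ~~ inEoa D -> j != D.
  by move=> jE; apply: contra => /eqP <-.
have aliveO : inEoa (sOrig i) by exact: (ltn_ord (lshift p i)).
have aliveA : inEoa (sAnti i) by exact: (ltn_ord (rshift p i)).
have QO k := (Qgen_exit_ge0 _ _ T s lam k).1.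
have QA k := (Qgen_exit_ge0 _ _ T s lam k).2.
have g_int j D : inEoa j -> ~~ inEoa D -> (forall k, 0 <= Qgen T s lam k D) ->
    lebesgue_measure.-integrable `[0, +oo[ (EFin \o g j D).
  move=> jE DE QD; apply: (integrable_exit_density _ _ _ _ _ _ _ hmark) => //.
  - exact: Qgen_absorbing.
  - exact: alive.
(* Each of the two exit densities is integrable by itself, so the integral of their difference
   splits into the two exit probabilities. *)
have measureE j f : inEoa j -> (forall x, f x = g j (sDeltaO p) x - g j (sDeltaA p) x) ->
    lebesgue_measure.-integrable `[0, +oo[ (EFin \o f) /\
    forall B : set R, measurable B -> B `<=` `[0, +oo[ ->
      exit_signed_measure P phi j B = Rintegral lebesgue_measure B f.
  move=> jE /funext ->; split.
    exact: (integrableB _ (g_int _ _ jE exitO QO) (g_int _ _ jE exitA QA)).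
  move=> B mB B0; rewrite RintegralB//; last 2 first.
  - by apply: integrableS (g_int _ _ jE exitO QO).
  - by apply: integrableS (g_int _ _ jE exitA QA).
  rewrite /exit_signed_measure /Rintegral.
  by congr (fine _ - fine _); apply: (exit_density _ _ _ _ _ _ _ hmark) => //;
    (exact: Qgen_absorbing || exact: alive).
have [x|intO measO] := measureE (sOrig i) fo aliveO.
  rewrite /g exit_density_diff /antisym_state_mx mul_col_mx col_mxEu.
  by rewrite mul_col_mx col_mxEu mul1mx.
have [x|intA measA] := measureE (sAnti i) fa aliveA.
  rewrite /g exit_density_diff /antisym_state_mx mul_col_mx col_mxEu.
  by rewrite mul_col_mx col_mxEd mulNmx mul1mx mxE.
(* The row vectors [(e_i, 0)] and [(0, e_i)] select the upper or the lower half of the antisymmetric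
   lift, whence the opposite signs. *)
split => //; split => x _; rewrite -mulmxA blockE.
- rewrite mul_col_mx mul_row_col mul0mx addr0 mul1mx -rowE.
  by rewrite [RHS]mxE.
- rewrite mul_col_mx mul_row_col mul0mx add0r mulNmx mul1mx -rowE.
  by rewrite [RHS]mxE [RHS]mxE.
Qed.
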